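(* Let $n\ge 1$ and let $G=K_{1,n}$ be the star graph (one central vertex joined to $n$ leaves). Let $q$ be an integer with $q>n$. Then for every probability distribution $(p_1,\ldots,p_q)$ (that is, $p_i\ge 0$ and $p_1+\cdots+p_q=1$), $$P_G(p_1,\ldots,p_q)\ \le\ P_G\left(\frac1q,\ldots,\frac1q\right).$$
   Context: For a finite simple graph $G=(V,E)$, a positive integer $q$ and a probability distribution $(p_1,\ldots,p_q)$ on the colors $\{1,\ldots,q\}$, color each vertex of $G$ independently at random, with color $i$ occurring with probability $p_i$. $P_G(p_1,\ldots,p_q)$ denotes the probability that the resulting coloring is proper, i.e. that no edge of $G$ has both endpoints of the same color. Equivalently, $P_G(p_1,\ldots,p_q)=\sum_{\alpha}\prod_{v\in V}p_{\alpha(v)}$, where the sum is over all maps $\alpha:V\to\{1,\ldots,q\}$ with $\alpha(u)\ne\alpha(v)$ for every edge $uv\in E$. *)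

(* Defs.v *)
From mathcomp Require Import all_boot all_order all_algebra.
From mathcomp Require Import reals.

Set Implicit Arguments.
Unset Strict Implicit.
Unset Printing Implicit Defensive.

Import Order.TTheory GRing.Theory Num.Theory.
Local Open Scope ring_scope.

Record sgraph := SGraph {
  vertex :> finType;
  adj : rel vertex;
  adj_sym : symmetric adj;
  adj_irrefl : irreflexive adj
}.

Section CompleteBipartite.
Variables m n : nat.

Definition Kmn_adj : rel ('I_m + 'I_n)%type := fun u v =>
  match u, v with
  | inl _, inr _ | inr _, inl _ => true
  | _, _ => false
  end.

Lemma Kmn_adj_sym : symmetric Kmn_adj.
Proof. by move=> [u|u] [v|v]. Qed.

Lemma Kmn_adj_irrefl : irreflexive Kmn_adj.
Proof. by move=> [u|u]. Qed.

Definition complete_bipartite : sgraph := SGraph Kmn_adj_sym Kmn_adj_irrefl.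

End CompleteBipartite.

Definition star (n : nat) : sgraph := complete_bipartite 1 n.

Definition proper_coloring (G : sgraph) (q : nat) (a : {ffun G -> 'I_q}) : bool :=
  [forall u, forall v, adj u v ==> (a u != a v)].

(* Each coloring [a] has probability [\prod_v p (a v)] when the vertices are
   colored independently with color distribution [p]. *)
Definition proper_prob (R : realType) (G : sgraph) (q : nat) (p : 'I_q -> R) : R :=
  \sum_(a : {ffun G -> 'I_q} | proper_coloring a) \prod_(v : G) p (a v).

(* Main.v *)
Require Import Defs.
From mathcomp Require Import all_boot all_order all_algebra.
From mathcomp Require Import reals.
From mathcomp Require Import ring lra.

(** Conditioning on the color of the center, the probability is the sum of
    [p i * (1 - p i) ^+ n]. Although [x * (1 - x) ^+ n] is not concave on
    [0, 1], its graph there still lies below its tangent at any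
    [a <= 1 / (n + 1)]. Summing the tangent bounds at [a = 1 / q], the linear
    terms cancel. *)

Import Order.TTheory GRing.Theory Num.Theory.
Local Open Scope ring_scope.

Lemma proper_prob_star (R : realType) (n q : nat) (p : 'I_q -> R) :
  \sum_(i < q) p i = 1 ->
  proper_prob (star n) p = \sum_(i < q) p i * (1 - p i) ^+ n.
Proof.
move=> p1; rewrite /proper_prob.
rewrite (partition_big (fun a : {ffun star n -> 'I_q} => a (inl ord0)) predT) //=.
apply: eq_bigr => i _.
(* [F v] is the set of colors allowed at [v] once the center has color [i]; leaves constrain only
   the center, so proper colorings form a product family. *)
pose F (v : 'I_1 + 'I_n) : pred 'I_q :=
  if v is inl _ then pred1 i else predC1 i.
transitivity (\prod_(v : 'I_1 + 'I_n) \sum_(j | F v j) p j); last first.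
  rewrite big_sumType /= big_ord1 big_pred1_eq; congr (_ * _).
  rewrite prodr_const card_ord; congr (_ ^+ _).
  by rewrite -p1 [in RHS](bigD1 i) //= addrAC subrr add0r.
rewrite bigA_distr_big_dep; apply: eq_bigl => a.
apply/andP/familyP => [[/forallP ha /eqP hi] [u|v]|ha].
- by rewrite ord1 inE hi.
- by have /forallP/(_ (inr v)) := ha (inl ord0); rewrite inE /= hi eq_sym.
- have hi : a (inl ord0) = i by apply/eqP; exact: (ha (inl ord0)).
  have hv v : a (inr v) != i by exact: (ha (inr v)).
  split; last by rewrite hi.
  by apply/forallP => -[u|u]; apply/forallP => -[v|v] //=;
    rewrite ord1 hi ?hv // eq_sym hv.
Qed.

(* The tangent bound at [b = 1 - a], in the variable [y = 1 - x], for
   exponent [m.+1]. *)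
Lemma tangent_bound (R : realFieldType) (m : nat) (b y : R) :
  0 <= b <= 1 -> 0 <= y -> m.+1%:R <= m.+2%:R * b ->
  y ^+ m.+1 - y ^+ m.+2 <= b ^+ m.+1 - b ^+ m.+2 +
    (m.+1%:R * b ^+ m - m.+2%:R * b ^+ m.+1) * (y - b).
Proof.
move=> /andP[b0 b1] y0.
elim: m => [|m IHm] hb; rewrite -subr_ge0.
  by rewrite [leRHS](_ : _ = (y - b) ^+ 2) ?sqr_ge0 //; ring.
have hb' : m.+1%:R <= m.+2%:R * b by move: hb; rewrite -!natr1; lra.
(* Multiplying the previous tangent by [y] gives a quadratic tangent to the new function at [b]. It
   differs from the new tangent by the old slope times [(y - b) ^+ 2], and [hb'] makes that slope
   nonpositive. *)
rewrite [leRHS](_ : _ = y * (b ^+ m.+1 - b ^+ m.+2 +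
    (m.+1%:R * b ^+ m - m.+2%:R * b ^+ m.+1) * (y - b)
    - (y ^+ m.+1 - y ^+ m.+2))
  + (y - b) ^+ 2 * (b ^+ m * (m.+2%:R * b - m.+1%:R))); last first.
  by rewrite -!natr1 !exprS; ring.
apply: addr_ge0; first by rewrite mulr_ge0 // subr_ge0 IHm.
by rewrite mulr_ge0 ?sqr_ge0 // mulr_ge0 ?exprn_ge0 // subr_ge0.
Qed.

Theorem theorem2p1 (R : realType) (n q : nat) (n_ge1 : (1 <= n)%N)
    (q_gt_n : (n < q)%N) (p : 'I_q -> R) (p_ge0 : forall i, 0 <= p i)
    (p_sum1 : \sum_(i < q) p i = 1) :
  proper_prob (star n) p <= proper_prob (star n) (fun _ : 'I_q => 1 / q%:R).
Proof.
have q_gt0 : 0 < q%:R :> R by rewrite ltr0n; exact: leq_ltn_trans q_gt_n.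
have unif1 : \sum_(i < q) 1 / q%:R = 1 :> R.
  by rewrite sumr_const card_ord -[LHS]mulr_natr divfK ?gt_eqF.
rewrite !proper_prob_star //.
case: n n_ge1 q_gt_n => [//|m] _ q_gt_m.
have p_le1 i : p i <= 1.
  by rewrite -p_sum1 (bigD1 i) //= lerDl sumr_ge0.
set a := 1 / q%:R in unif1 *.
have a_ge0 : 0 <= a by rewrite divr_ge0 ?ltW.
(* Here [n < q] enters: with [n = m.+1] it reads [m.+2 <= q], which puts [a] in the range of the
   tangent bound. *)
have ma_le1 : m.+2%:R * a <= 1.
  by rewrite mulrA mulr1 ler_pdivrMr // mul1r ler_nat.
have a_le1 : a <= 1.
  by apply: le_trans ma_le1; rewrite ler_peMl // ler1n.
(* The slope is taken in [y = 1 - x], hence the factor [a - p i] below. *)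
pose c := m.+1%:R * (1 - a) ^+ m - m.+2%:R * (1 - a) ^+ m.+1.
apply: (@le_trans _ _
  (\sum_(i < q) (a * (1 - a) ^+ m.+1 + c * (a - p i)))); last first.
  by rewrite big_split /= -[X in _ + X]mulr_sumr sumrB p_sum1 unif1 subrr mulr0 addr0.
apply: ler_sum => i _.
have b01 : 0 <= 1 - a <= 1 by rewrite subr_ge0 a_le1 gerBl.
have y_ge0 : 0 <= 1 - p i by rewrite subr_ge0.
have hb : m.+1%:R <= m.+2%:R * (1 - a).
  by move: ma_le1; rewrite -[m.+2%:R]natr1; lra.
have := tangent_bound R m (1 - a) (1 - p i) b01 y_ge0 hb.
rewrite -/c (exprS (1 - p i) m.+1) (exprS (1 - a) m.+1).
set u := _ ^+ m.+1; set v := (1 - a) ^+ m.+1; lra.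
Qed.
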